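(* Assume $0<\alpha<1$ and $E\in \mathrm{Swath}(\alpha)$. Let $X_E(\alpha)$ and $(y_E(\alpha),S_E(\alpha))$ be the optimal solutions of $\mathrm{QP}_E(\alpha)$ and $\mathrm{QP}_E(\alpha)^*$, respectively. Define \[ E'=\frac{1}{1+t_E(\alpha)}\big(E+t_E(\alpha)\,X_E(\alpha)\big), \] where $t_E(\alpha)$ minimizes the convex quadratic polynomial $t\mapsto \mathrm{tr}\Big(\big((E+t\,X_E(\alpha))\,S_E(\alpha)\big)^2\Big)$. Then (i) $E'\in\mathrm{Swath}(\alpha)$; (ii) $\mathrm{tr}(CE)>\mathrm{tr}(CE')$; (iii) $b^Ty_E(\alpha)\le b^Ty_{E'}(\alpha)$. Moreover, if, beginning with $E_0\in\mathrm{Swath}(\alpha)$, this rule is applied recursively to produce a sequence $E_0,E_1,\ldots$ (with $E_{i+1}=E_i'$), then for every $i=0,1,\ldots$, \[ \frac{\mathrm{gap}_{E_{j+1}}}{\mathrm{gap}_{E_j}}\le 1-\frac{\kappa}{\kappa+\sqrt n}\quad\text{for } j=i \text{ or } j=i+1 \text{ (possibly both)},\qquad \kappa:=\alpha\sqrt{\tfrac{1-\alpha}{8}}. \]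
   Context: $\mathbb{S}^n$ is the space of real symmetric $n\times n$ matrices, $\mathbb{S}^n_{+}$ ($\mathbb{S}^n_{++}$) the positive semidefinite (definite) cone. Given $C,A_1,\ldots,A_m\in\mathbb{S}^n$ and $b\in\mathbb{R}^m$, let $\mathcal{A}(X)=(\mathrm{tr}(A_1X),\ldots,\mathrm{tr}(A_mX))$ and $\mathcal{A}^*y=\sum_i y_iA_i$. The semidefinite program is SDP: $\min\ \mathrm{tr}(CX)$ s.t. $\mathcal{A}(X)=b$, $X\succeq 0$, with dual $\max\ b^Ty$ s.t. $\mathcal{A}^*y+S=C$, $S\succeq0$. Standing assumptions: both SDP and its dual are strictly feasible (feasible points with $X$, resp. $S$, positive definite exist); $b\neq0$; $C$ is not a linear combination of $A_1,\ldots,A_m$; $A_1,\ldots,A_m$ are linearly independent. For $E\in\mathbb{S}^n_{++}$ define $\langle U,V\rangle_E=\mathrm{tr}(E^{-1}UE^{-1}V)$, $\|V\|_E=\langle V,V\rangle_E^{1/2}$, and for $\alpha>0$ the cone $K_E(\alpha)=\{X\in\mathbb{S}^n:\ \mathrm{tr}(E^{-1}X)\ge \alpha\|X\|_E\}$. $K_E(\alpha)^*$ denotes its dual cone with respect to the trace inner product, $\{S:\mathrm{tr}(XS)\ge0\ \forall X\in K_E(\alpha)\}$. $\mathrm{QP}_E(\alpha)$ is the problem $\min\ \mathrm{tr}(CX)$ s.t. $\mathcal{A}(X)=b$, $X\in K_E(\alpha)$; its dual $\mathrm{QP}_E(\alpha)^*$ is $\max\ b^Ty$ s.t. $\mathcal{A}^*y+S=C$,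 $S\in K_E(\alpha)^*$. $\mathrm{Swath}(\alpha)=\{E\in\mathbb{S}^n_{++}:\ \mathcal{A}(E)=b \text{ and } \mathrm{QP}_E(\alpha) \text{ has an optimal solution}\}$. For $E\in\mathrm{Swath}(\alpha)$, $\mathrm{gap}_E:=\mathrm{tr}(CE)-b^Ty_E(\alpha)$ where $(y_E(\alpha),S_E(\alpha))$ is the optimal solution of $\mathrm{QP}_E(\alpha)^*$. *)

(* Defs.v *)
From HB Require Import structures.
From mathcomp Require Import all_boot all_order all_algebra.
From mathcomp Require Import reals.
Set Implicit Arguments. Unset Strict Implicit. Unset Printing Implicit Defensive.
Import Order.TTheory GRing.Theory Num.Theory.
Local Open Scope ring_scope.

Section SDP.
Context {R : realType} {n m : nat}.

Definition symmx (X : 'M[R]_n) : Prop := X^T = X.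
Definition psdmx (X : 'M[R]_n) : Prop :=
  symmx X /\ forall x : 'cV[R]_n, 0 <= (x^T *m X *m x) 0 0.
Definition pdmx (X : 'M[R]_n) : Prop :=
  symmx X /\ forall x : 'cV[R]_n, x != 0 -> 0 < (x^T *m X *m x) 0 0.

Definition Aop (A : 'I_m -> 'M[R]_n) (X : 'M[R]_n) : 'cV[R]_m :=
  \col_i \tr (A i *m X).
Definition Astar (A : 'I_m -> 'M[R]_n) (y : 'cV[R]_m) : 'M[R]_n :=
  \sum_i y i ord0 *: A i.
Definition bty (b y : 'cV[R]_m) : R := \sum_i b i ord0 * y i ord0.

Definition standing (C : 'M[R]_n) (A : 'I_m -> 'M[R]_n) (b : 'cV[R]_m) : Prop :=
  symmx C /\ (forall i, symmx (A i)) /\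
  (exists X, pdmx X /\ Aop A X = b) /\
  (exists y S, pdmx S /\ Astar A y + S = C) /\
  b != 0 /\
  ~ (exists y, C = Astar A y) /\
  (forall y, Astar A y = 0 -> y = 0).
(* components: C, A_i symmetric; primal strictly feasible; dual strictly
   feasible; b <> 0; C not in span of A_i; A_i linearly independent *)

Definition ipE (E U V : 'M[R]_n) : R := \tr (invmx E *m U *m invmx E *m V).
Definition normE (E V : 'M[R]_n) : R := Num.sqrt (ipE E V V).
Definition Kcone (E : 'M[R]_n) (alpha : R) (X : 'M[R]_n) : Prop :=
  symmx X /\ alpha * normE E X <= \tr (invmx E *m X).
Definition Kdual (E : 'M[R]_n) (alpha : R) (S : 'M[R]_n) : Prop :=
  symmx S /\ forall X, Kcone E alpha X -> 0 <= \tr (X *m S).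

Definition QPfeas (A : 'I_m -> 'M[R]_n) (b : 'cV[R]_m) E alpha X : Prop :=
  Aop A X = b /\ Kcone E alpha X.
Definition QPopt (C : 'M[R]_n) A b E alpha X : Prop :=
  QPfeas A b E alpha X /\
  forall X', QPfeas A b E alpha X' -> \tr (C *m X) <= \tr (C *m X').
Definition QPDfeas (C : 'M[R]_n) (A : 'I_m -> 'M[R]_n) E alpha y S : Prop :=
  Astar A y + S = C /\ Kdual E alpha S.
Definition QPDopt (C : 'M[R]_n) A (b : 'cV[R]_m) E alpha y S : Prop :=
  QPDfeas C A E alpha y S /\
  forall y' S', QPDfeas C A E alpha y' S' -> bty b y' <= bty b y.

Definition Swath (C : 'M[R]_n) A b (alpha : R) (E : 'M[R]_n) : Prop :=
  [/\ pdmx E, Aop A E = b & (exists X, QPopt C A b E alpha X)].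

Definition gapE (C : 'M[R]_n) (b : 'cV[R]_m) (E : 'M[R]_n) (y : 'cV[R]_m) : R :=
  \tr (C *m E) - bty b y.

Definition tquad (E X S : 'M[R]_n) (t : R) : R :=
  \tr (((E + t *: X) *m S) *m ((E + t *: X) *m S)).
Definition update (E X : 'M[R]_n) (t : R) : 'M[R]_n :=
  (1 + t)^-1 *: (E + t *: X).

End SDP.

Definition kappa {R : realType} (alpha : R) : R :=
  alpha * Num.sqrt ((1 - alpha) / 8).

(* Main.v *)
Require Import Defs.
From HB Require Import structures.
From mathcomp Require Import all_boot all_order all_algebra.
From mathcomp Require Import reals.
From mathcomp Require Import boolp classical_sets functions topology normedtype derive.
From mathcomp Require Import ring lra.
Import Order.TTheory GRing.Theory Num.Theory numFieldNormedType.Exports.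
Local Open Scope ring_scope.

(** In the local coordinates [Z = B^-1 X B^-T], [T = B^T S B] with [E = B B^T],
    an optimal [X] lies on the boundary of [K_E(alpha)] and the dual slack [S] is
    a positive multiple of the gradient of the cone at [X], so that
    [T = nu (N - alpha Z)] with [N = |X|_E]; in particular [tr (X S) = 0] and
    [gap_E = tr (E S)].  The minimizer [t] of [q(t) = tr (((E + t X) S)^2)] is then
    an explicit quotient of power sums of [Z], which gives [t >= alpha / (2 N)] and
    [(n - beta^2) q(t) <= tr (E S)^2] for [beta = alpha sqrt ((1 + alpha) / 2)].

    The latter inequality says that [S] lies in the dual of the wider cone
    [K_E'(beta)], hence in the interior of the dual of [K_E'(alpha)]: the new
    problem attains its minimum and the old dual point remains feasible.  Moreover
    the gap is divided by at least [1 + t], and the dual value increases by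
    [tr (S X')], where [X'] solves the new problem, which is at least
    [(alpha - beta) |X'|_E' / n] times [tr (E' S)].  If [|X'|_E'] is small, the next
    step length is at least [kappa / sqrt n]; if it is large, the dual gain of the
    present step suffices. *)

(** * Frobenius norm inequalities *)

Section TraceInnerProduct.
Context {R : realType}.

Lemma mxtrace_mul_tr {p q : nat} (X Y : 'M[R]_(p, q)) :
  \tr (X *m Y^T) = \sum_i \sum_j X i j * Y i j.
Proof.
by apply: eq_bigr => i _; rewrite mxE; apply: eq_bigr => j _; rewrite mxE.
Qed.

Lemma mxtrace_mul_tr_ge0 {p q : nat} (X : 'M[R]_(p, q)) : 0 <= \tr (X *m X^T).
Proof.
rewrite mxtrace_mul_tr; do 2 (apply: sumr_ge0 => ? _).
by rewrite -expr2 sqr_ge0.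
Qed.

Lemma sqr_entry_le_mxtrace {p q : nat} (X : 'M[R]_(p, q)) i j :
  X i j ^+ 2 <= \tr (X *m X^T).
Proof.
rewrite mxtrace_mul_tr (bigD1 i) //= (bigD1 j) //= -expr2 -addrA lerDl.
apply: addr_ge0; first by apply: sumr_ge0 => k _; rewrite -expr2 sqr_ge0.
by apply: sumr_ge0 => l _; apply: sumr_ge0 => k _; rewrite -expr2 sqr_ge0.
Qed.

Lemma mxtrace_mul_tr_eq0 {p q : nat} (X : 'M[R]_(p, q)) :
  \tr (X *m X^T) = 0 -> X = 0.
Proof.
move=> X0; apply/matrixP => i j; rewrite mxE; apply/eqP.
by rewrite -sqrf_eq0 eq_le sqr_ge0 -X0 sqr_entry_le_mxtrace.
Qed.

Lemma mxtrace_CauchySchwarz {p q : nat} (X Y : 'M[R]_(p, q)) :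
  \tr (X *m Y^T) ^+ 2 <= \tr (X *m X^T) * \tr (Y *m Y^T).
Proof.
have [X0|Xn0] := eqVneq (\tr (X *m X^T)) 0.
  by rewrite (mxtrace_mul_tr_eq0 _ X0) !mul0mx mxtrace0 expr0n mul0r.
have Xgt0 : 0 < \tr (X *m X^T) by rewrite lt_def Xn0 mxtrace_mul_tr_ge0.
set a := \tr (X *m X^T); set c := \tr (Y *m Y^T); set d := \tr (X *m Y^T).
have := mxtrace_mul_tr_ge0 (a *: Y - d *: X).
have -> : \tr ((a *: Y - d *: X) *m (a *: Y - d *: X)^T) = a * (a * c - d ^+ 2).
  have dC : \tr (Y *m X^T) = d by rewrite -mxtrace_tr trmx_mul trmxK.
  rewrite [(_ - _)^T]raddfB /= ![(_ *: _)^T]linearZ /=.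
  rewrite mulmxBl !mulmxBr -!scalemxAl -!scalemxAr.
  rewrite !raddfB /= !mxtraceZ dC -/a -/c -/d; ring.
by rewrite pmulr_rge0 // subr_ge0.
Qed.

Lemma mxtrace_mul_submult {p q r : nat} (X : 'M[R]_(p, q)) (Y : 'M[R]_(q, r)) :
  \tr ((X *m Y) *m (X *m Y)^T) <= \tr (X *m X^T) * \tr (Y *m Y^T).
Proof.
have -> : \tr (Y *m Y^T) = \tr (Y^T *m Y^T^T) by rewrite trmxK mxtrace_mulC.
rewrite !mxtrace_mul_tr big_distrlr /=.
apply: ler_sum => i _; apply: ler_sum => j _.
have := mxtrace_CauchySchwarz (row i X) (row j Y^T).
rewrite !mxtrace_mul_tr !big_ord1 -expr2 mxE => /le_trans.
have -> : \sum_k X i k * Y k j = \sum_k row i X 0 k * row j Y^T 0 k.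
  by apply: eq_bigr => k _; rewrite !mxE.
apply; rewrite le_eqVlt; apply/orP; left; apply/eqP.
by congr (_ * _); apply: eq_bigr => k _; rewrite !mxE.
Qed.

End TraceInnerProduct.

(** * Trace criteria for positive definiteness *)

Section PositiveDefinite.
Context {R : realType}.

Lemma quad_form_mxtrace {n : nat} (W : 'M[R]_n) (x : 'cV[R]_n) :
  (x^T *m W *m x) 0 0 = \tr (W *m (x *m x^T)).
Proof. by rewrite -trace_mx11 -mulmxA mxtrace_mulC -mulmxA. Qed.

Lemma sqnorm_cV_gt0 {n : nat} (x : 'cV[R]_n) : x != 0 -> 0 < \tr (x *m x^T).
Proof.
move=> x0; rewrite lt_def mxtrace_mul_tr_ge0 andbT.
by apply: contra_neq x0 => /mxtrace_mul_tr_eq0.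
Qed.

(* If x^T W x <= 0, then \tr W is at most the inner product of W with the
   projection onto the orthogonal complement of x, whose norm is sqrt (n - 1). *)
Lemma pdmx_of_mxtrace {n : nat} (W : 'M[R]_n) : symmx W -> 0 < \tr W ->
  (n%:R - 1) * \tr (W *m W) < \tr W ^+ 2 -> pdmx W.
Proof.
move=> symW trW0 ltW; split=> // x x0; rewrite ltNge; apply/negP => xWx.
have s0 := sqnorm_cV_gt0 _ x0.
set s := \tr (x *m x^T) in s0; pose Q := 1%:M - s^-1 *: (x *m x^T).
have QT : Q^T = Q by rewrite raddfB /= tr_scalar_mx linearZ /= trmx_mul trmxK.
have ss : s^-1 * s = 1 by rewrite mulVf // gt_eqF.
have QQ : Q *m Q^T = Q.
  rewrite QT mulmxBl mul1mx mulmxBr mulmx1 -scalemxAl -scalemxAr.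
  rewrite mulmxA -(mulmxA x x^T x) [x^T *m x]mx11_scalar -trace_mx11.
  rewrite (mxtrace_mulC x^T) -/s mul_mx_scalar -scalemxAl [s^-1 *: (s *: _)]scalerA.
  by rewrite ss scale1r subrr subr0.
have := mxtrace_CauchySchwarz W Q; rewrite QQ QT symW.
have -> : \tr Q = n%:R - 1.
  by rewrite raddfB /= mxtrace1 linearZ /= -/s ss.
have trWQ : \tr W <= \tr (W *m Q).
  rewrite mulmxBr mulmx1 raddfB /= -scalemxAr linearZ /= -quad_form_mxtrace.
  by rewrite lerDl oppr_ge0 pmulr_rle0 // invr_gt0.
rewrite mulrC leNgt => /negP; apply; apply: (lt_le_trans ltW).
by rewrite ler_sqr ?nnegrE; lra.
Qed.

(* With a = x^T S x and d = x^T S^2 x, Cauchy-Schwarz gives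
   a^2 <= |x|^2 d, while the hypothesis gives f d < c a. *)
Lemma pdmx_factor {n : nat} (S : 'M[R]_n) (c f : R) : pdmx S -> 0 <= f ->
  pdmx (c *: S - f *: (S *m S)) -> pdmx (c%:M - f *: S).
Proof.
move=> [symS Spos] f0 [_ Wpos]; split=> [|x x0].
  by rewrite /symmx raddfB /= tr_scalar_mx linearZ /= symS.
have := Wpos _ x0; have := Spos _ x0; have s0 := sqnorm_cV_gt0 _ x0.
rewrite !quad_form_mxtrace !mulmxBl -!scalemxAl mul_scalar_mx !raddfB /= !mxtraceZ.
have CS := mxtrace_CauchySchwarz x (S *m x).
have e1 : \tr (x *m (S *m x)^T) = \tr (S *m (x *m x^T)).
  by rewrite trmx_mul symS mxtrace_mulC -mulmxA mxtrace_mulC -mulmxA.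
have e2 : \tr (S *m x *m (S *m x)^T) = \tr (S *m S *m (x *m x^T)).
  by rewrite trmx_mul symS [in LHS]mulmxA [LHS]mxtrace_mulC !mulmxA.
move: CS; rewrite e1 e2.
set s := \tr (x *m x^T) in s0 *; set a := \tr (S *m _); set d := \tr (S *m S *m _).
move=> CS a0 h.
(* Multiplied by a: a (c s - f a) >= s (c a - f d) > 0. *)
rewrite -(pmulr_lgt0 _ a0); nra.
Qed.

End PositiveDefinite.

(** * Cholesky factorization and congruence *)

Section Congruence.
Context {R : realType}.

(** Induction on the size: the Schur complement [D] of the first pivot is again positive definite,
    and its factor [L] is bordered by the first column of [E] divided by sqrt a. *)
Lemma pdmx_cholesky {n : nat} (E : 'M[R]_n) : pdmx E ->
  exists2 B : 'M[R]_n, B \in unitmx & E = B *m B^T.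
Proof.
elim: n E => [|n IHn] E [symE posE].
  by exists 1%:M; [exact: unitmx1 | rewrite [LHS]flatmx0 [RHS]flatmx0].
rewrite -[n.+1]/(1 + n)%N in E symE posE *.
pose v := dlsubmx E; pose a := E 0 0.
have ulE : ulsubmx E = a%:M.
  by rewrite [LHS]mx11_scalar !mxE; congr (E _ _)%:M; apply: val_inj.
have urE : ursubmx E = v^T by rewrite -{1}symE -trmx_dlsub.
have defE : E = block_mx a%:M v^T v (drsubmx E).
  by rewrite -ulE -urE submxK.
pose D := drsubmx E - a^-1 *: (v *m v^T).
have a0 : 0 < a.
  have /posE : col_mx 1%:M 0 != 0 :> 'cV[R]_(1 + n).
    apply/eqP => /colP/(_ (lshift n 0)); rewrite col_mxEu !mxE => /eqP.
    by rewrite oner_eq0.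
  rewrite defE tr_col_mx mul_row_block mul_row_col !trmx0 tr_scalar_mx.
  by rewrite !mulmx0 addr0 mul0mx !mul1mx mulmx1 addr0 mxE mulr1n.
have [|L uL defD] := IHn D.
  split=> [|y y0].
    rewrite /symmx raddfB /= -{1}symE -trmx_drsub trmxK.
    by rewrite linearZ /= trmx_mul trmxK.
  (* This first coordinate minimizes the form of [E] for given [y]; the minimum is the form of [D]
     at [y]. *)
  have /posE : col_mx (- (a^-1 *: (v^T *m y))) y != 0 :> 'cV[R]_(1 + n).
    by apply: contra_neq y0 => /colP y0; apply/colP => i;
       have := y0 (rshift 1 i); rewrite col_mxEd !mxE.
  rewrite {1}defE tr_col_mx mul_row_block mul_row_col.
  rewrite [(- _)^T]raddfN /= [(_ *: _)^T]linearZ /= trmx_mul trmxK.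
  have -> : - (a^-1 *: (y^T *m v)) *m a%:M + y^T *m v = 0.
    by rewrite mul_mx_scalar scalerN scalerA mulfV ?gt_eqF // scale1r addNr.
  rewrite mul0mx add0r /D mulmxBr mulmxBl mulmxDl mulNmx addrC.
  by rewrite -!scalemxAr -!scalemxAl mulNmx -scalemxAl !mulmxA.
pose q := Num.sqrt a; have q0 : q != 0 by rewrite sqrtr_eq0 -ltNge.
have qq : q * q = a by rewrite -expr2 sqr_sqrtr // ltW.
exists (block_mx q%:M 0 (q^-1 *: v) L).
  rewrite unitmxE det_lblock det_scalar1 unitrM -unitmxE uL andbT.
  by rewrite unitfE.
rewrite tr_block_mx mulmx_block !trmx0 tr_scalar_mx !mulmx0 !mul0mx !addr0.
rewrite -scalar_mxM qq mul_mx_scalar mul_scalar_mx [(_ *: _)^T]linearZ /=.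
rewrite !scalerA mulfV // !scale1r -defD -scalemxAl -scalemxAr scalerA -invfM qq.
by rewrite /D addrC subrK.
Qed.

Lemma pdmx_congr {n : nat} (B W : 'M[R]_n) : B \in unitmx -> pdmx W ->
  pdmx (B *m W *m B^T).
Proof.
move=> uB [symW posW]; split=> [|x x0].
  by rewrite /symmx !trmx_mul trmxK symW mulmxA.
have /posW : B^T *m x != 0.
  by apply: contra_neq x0 => Bx0; rewrite -(mulKmx (_ : B^T \in unitmx) x)
    ?Bx0 ?mulmx0 // unitmx_tr.
by rewrite trmx_mul trmxK !mulmxA.
Qed.

End Congruence.

(** * Local coordinates at E = B B^T *)

Section LocalCoordinates.
Context {R : realType} {n : nat} {B : 'M[R]_n} (uB : B \in unitmx).

(* X = B Z B^T and S = B^-T T B^-1 turn the local inner products at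
   E = B B^T into the trace inner product. *)
Definition pcoord (X : 'M[R]_n) : 'M[R]_n := invmx B *m X *m (invmx B)^T.
Definition dcoord (S : 'M[R]_n) : 'M[R]_n := B^T *m S *m B.

Lemma invmx_gram : invmx (B *m B^T) = (invmx B)^T *m invmx B.
Proof.
have uE : B *m B^T \in unitmx by rewrite unitmx_mul unitmx_tr uB.
apply: (can_inj (mulKmx uE)); rewrite mulmxV // trmx_inv mulmxA.
by rewrite mulmxK ?unitmx_tr // mulmxV.
Qed.

Lemma pcoordK X : B *m pcoord X *m B^T = X.
Proof.
rewrite /pcoord !mulmxA mulmxV // mul1mx -mulmxA trmx_inv mulVmx ?mulmx1 //.
by rewrite unitmx_tr.
Qed.

Lemma pcoordKV Z : pcoord (B *m Z *m B^T) = Z.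
Proof.
rewrite /pcoord !mulmxA mulVmx // mul1mx -mulmxA trmx_inv mulmxV ?mulmx1 //.
by rewrite unitmx_tr.
Qed.

Lemma pcoord_sym X : symmx X -> symmx (pcoord X).
Proof. by move=> sX; rewrite /symmx !trmx_mul trmxK sX mulmxA. Qed.

Lemma dcoord_sym S : symmx S -> symmx (dcoord S).
Proof. by move=> sS; rewrite /symmx !trmx_mul trmxK sS mulmxA. Qed.

Lemma mxtrace_pcoord X : \tr (invmx (B *m B^T) *m X) = \tr (pcoord X).
Proof. by rewrite invmx_gram -mulmxA [LHS]mxtrace_mulC. Qed.

Lemma mxtrace_dcoord S : \tr (B *m B^T *m S) = \tr (dcoord S).
Proof. by rewrite -mulmxA [LHS]mxtrace_mulC. Qed.

(** Primal and dual coordinates are opposite congruences, so products [X *m S] are merely conjugated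
    and traces of their powers survive. *)
Lemma mul_pcoord_dcoord X S :
  pcoord X *m dcoord S = invmx B *m (X *m S) *m B.
Proof.
rewrite /pcoord /dcoord !mulmxA trmx_inv -(mulmxA _ (invmx B^T)) mulVmx.
  by rewrite mulmx1.
by rewrite unitmx_tr.
Qed.

Lemma mxtrace_mul_coord X S : \tr (X *m S) = \tr (pcoord X *m dcoord S).
Proof.
by rewrite mul_pcoord_dcoord [RHS]mxtrace_mulC mulmxA mulmxV // mul1mx.
Qed.

Lemma ipE_pcoord U V : ipE (B *m B^T) U V = \tr (pcoord U *m pcoord V).
Proof.
rewrite /ipE invmx_gram /pcoord -!mulmxA [LHS]mxtrace_mulC.
by rewrite !mulmxA.
Qed.

Lemma pcoord_self : pcoord (B *m B^T) = 1%:M.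
Proof. by rewrite -[X in pcoord (X *m _)]mulmx1 pcoordKV. Qed.

Lemma pcoordD U V : pcoord (U + V) = pcoord U + pcoord V.
Proof. by rewrite /pcoord mulmxDr mulmxDl. Qed.

Lemma pcoordZ a U : pcoord (a *: U) = a *: pcoord U.
Proof. by rewrite /pcoord -scalemxAr -scalemxAl. Qed.

Lemma mxtrace_mul4_coord X S :
  \tr (X *m S *m (X *m S)) =
  \tr (pcoord X *m dcoord S *m (pcoord X *m dcoord S)).
Proof.
rewrite mul_pcoord_dcoord; set M := X *m S; set P := invmx B.
have -> : P *m M *m B *m (P *m M *m B) = P *m (M *m M *m B).
  by rewrite !mulmxA -(mulmxA _ B P) mulmxV // mulmx1.
by rewrite [RHS]mxtrace_mulC -(mulmxA _ B P) mulmxV // mulmx1.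
Qed.

Lemma tquad_coord X S t : tquad (B *m B^T) X S t =
  \tr ((1%:M + t *: pcoord X) *m dcoord S *m ((1%:M + t *: pcoord X) *m dcoord S)).
Proof. by rewrite /tquad mxtrace_mul4_coord pcoordD pcoordZ pcoord_self. Qed.

End LocalCoordinates.

(** * One step at the identity *)

Section StepAtIdentity.
Context {R : realType}.

Lemma quad_argmin (k0 k1 k2 t : R) : 0 < k2 ->
  (forall s, k0 + 2 * k1 * t + k2 * t ^+ 2 <= k0 + 2 * k1 * s + k2 * s ^+ 2) ->
  k2 * t = - k1.
Proof.
move=> k20 /(_ (- k1 / k2)) tmin; have k2n0 : k2 != 0 by rewrite gt_eqF.
have e : k0 + 2 * k1 * (- k1 / k2) + k2 * (- k1 / k2) ^+ 2 =
    k0 + 2 * k1 * t + k2 * t ^+ 2 - k2^-1 * (k2 * t + k1) ^+ 2 by field.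
apply/eqP; rewrite -addr_eq0 -sqrf_eq0 eq_le sqr_ge0 andbT.
by rewrite -(pmulr_rle0 (x := k2^-1)) ?invr_gt0 //; lra.
Qed.

Lemma mxtrace_sqr_poly2 {n : nat} (Z : 'M[R]_n) (a b c : R) :
  let W := a%:M + b *: Z + c *: (Z *m Z) in
  \tr (W *m W) = a ^+ 2 * n%:R + 2 * a * b * \tr Z
    + (b ^+ 2 + 2 * a * c) * \tr (Z *m Z)
    + 2 * b * c * \tr (Z *m (Z *m Z)) + c ^+ 2 * \tr (Z *m Z *m (Z *m Z)).
Proof.
move=> W; rewrite /W !mulmxDl !mulmxDr -!scalar_mxM.
rewrite !(mul_scalar_mx, mul_mx_scalar) -!scalemxAl -!scalemxAr !mxtraceD !mxtraceZ.
rewrite mxtrace_scalar -!mulmxA -mulr_natr; ring.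
Qed.

(** Cauchy-Schwarz for Z and Z^2, then submultiplicativity; these are the bounds on the higher power
    sums that control the step. *)
Lemma mxtrace_cube_quartic {n : nat} (Z : 'M[R]_n) : symmx Z ->
  \tr (Z *m (Z *m Z)) ^+ 2 <= \tr (Z *m Z) * \tr (Z *m Z *m (Z *m Z)) /\
  \tr (Z *m Z *m (Z *m Z)) <= \tr (Z *m Z) ^+ 2.
Proof.
move=> sZ; have sZZ : (Z *m Z)^T = Z *m Z by rewrite trmx_mul sZ.
split; first by have := mxtrace_CauchySchwarz Z (Z *m Z); rewrite sZZ sZ.
by have := mxtrace_mul_submult Z Z; rewrite sZZ sZ -expr2.
Qed.

(** Since (I + s Z) T is a quadratic polynomial in [Z], the first two bounds become polynomial
    inequalities in [N], [p3] and [p4]. Definiteness rests on the trace of (I + s Z) T not depending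
    on s. *)
Lemma step_at_identity {n : nat} (Z : 'M[R]_n) (alpha nu N t : R) :
  let T := nu *: (N%:M - alpha *: Z) in
  let q s := \tr ((1%:M + s *: Z) *m T *m ((1%:M + s *: Z) *m T)) in
  (0 < n)%N -> 0 < alpha < 1 -> 0 < nu -> 0 < N -> symmx Z ->
  \tr Z = alpha * N -> \tr (Z *m Z) = N ^+ 2 -> (forall s, q t <= q s) ->
  [/\ alpha / (2 * N) <= t,
      (n%:R - alpha ^+ 2 * (1 + alpha) / 2) * q t <= \tr T ^+ 2,
      0 < \tr T & pdmx (1%:M + t *: Z)].
Proof.
move=> T q n0 /andP[a0 a1] nu0 N0 sZ trZ trZZ tmin.
have n1 : 1 <= n%:R :> R by rewrite ler1n.
have [] := mxtrace_cube_quartic Z sZ; rewrite trZZ.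
set p3 := \tr (Z *m (Z *m Z)); set p4 := \tr (Z *m Z *m (Z *m Z)) => p34 p4N.
pose W s := (1%:M + s *: Z) *m T.
have WE s : W s = (nu * N)%:M + (nu * (s * N - alpha)) *: Z
      + (- (nu * alpha * s)) *: (Z *m Z).
  rewrite /W /T -scalemxAr mulmxBr mulmxDl mul1mx mul_mx_scalar mulmxDl mul1mx.
  rewrite -!scalemxAr -!scalemxAl -!scale_scalar_mx.
  apply/matrixP => i j; rewrite !mxE; ring.
pose k1 := alpha ^+ 2 * p3 - alpha * N ^+ 3.
pose k2 := N ^+ 4 - 2 * alpha * N * p3 + alpha ^+ 2 * p4.
pose k0 := N ^+ 2 * (n%:R - alpha ^+ 2).
have qE s : q s = nu ^+ 2 * (k0 + 2 * k1 * s + k2 * s ^+ 2).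
  rewrite /q -/(W s) WE mxtrace_sqr_poly2 trZ trZZ -/p3 -/p4 /k0 /k1 /k2; ring.
have trT : \tr T = nu * N * (n%:R - alpha ^+ 2).
  rewrite /T mxtraceZ raddfB /= mxtrace_scalar mxtraceZ trZ -mulr_natr; ring.
have a21 : alpha ^+ 2 < 1 by nra.
have trT0 : 0 < \tr T by rewrite trT; do 2 (apply: mulr_gt0; try lra); lra.
have p3N : p3 ^+ 2 <= (N ^+ 3) ^+ 2 by nra.
have N30 : 0 < N ^+ 3 by rewrite exprn_gt0.
have p3le : p3 <= N ^+ 3 by nra.
have p3ge : - N ^+ 3 <= p3 by nra.
have D0 : 0 < N ^+ 3 - alpha * p3 by nra.
have N20 : 0 < N ^+ 2 by rewrite exprn_gt0.
have k20 : 0 < k2.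
  rewrite -(pmulr_rgt0 _ N20); apply: (lt_le_trans (exprn_gt0 2 D0)).
  rewrite -subr_ge0.
  have -> : N ^+ 2 * k2 - (N ^+ 3 - alpha * p3) ^+ 2 =
    alpha ^+ 2 * (N ^+ 2 * p4 - p3 ^+ 2) by rewrite /k2; ring.
  by rewrite mulr_ge0 ?sqr_ge0 // subr_ge0.
have kt : k2 * t = - k1.
  apply: (quad_argmin k0) => // s; have := tmin s.
  by rewrite !qE ler_pM2l // exprn_gt0.
have tge : alpha / (2 * N) <= t.
  rewrite ler_pdivrMr; last lra.
  rewrite -(ler_pM2l k20) mulrA kt -subr_ge0.
  have -> : - k1 * (2 * N) - k2 * alpha = alpha * (N ^+ 4 - alpha ^+ 2 * p4).
    by rewrite /k1 /k2; ring.
  apply: mulr_ge0; first exact: ltW.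
  have N4 : 0 <= (N ^+ 2) ^+ 2 by rewrite sqr_ge0.
  have -> : N ^+ 4 = (N ^+ 2) ^+ 2 by ring.
  rewrite subr_ge0; nra.
have k00 : 0 < k0 by rewrite mulr_gt0 //; lra.
have qt : (n%:R - alpha ^+ 2 * (1 + alpha) / 2) * q t <= \tr T ^+ 2.
  (* Put d = alpha^2 (1 - alpha) / 2. This says that minimizing lowers q / nu^2 from k0 by k1^2 / k2
     >= d N^2. The constant in the claim is n - alpha^2 + d, so the claim reduces to (n - alpha^2 +
     d) (n - alpha^2 - d) <= (n - alpha^2)^2. *)
  have decr : (1 - alpha) * (N ^+ 2 * k2) <= 2 * (N ^+ 3 - alpha * p3) ^+ 2.
    have ub : N ^+ 2 * k2 <=
        (N ^+ 3) ^+ 2 * (1 + alpha ^+ 2) - 2 * N ^+ 3 * (alpha * p3).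
      rewrite -subr_ge0.
      have -> : (N ^+ 3) ^+ 2 * (1 + alpha ^+ 2) - 2 * N ^+ 3 * (alpha * p3) -
        N ^+ 2 * k2 = alpha ^+ 2 * (N ^+ 2 * ((N ^+ 2) ^+ 2 - p4)).
        by rewrite /k2; ring.
      by do 2 (apply: mulr_ge0; first exact: sqr_ge0); rewrite subr_ge0.
    apply: le_trans (ler_wpM2l _ ub) _; first lra.
    (* In terms of the slack [w] of p3 <= N^3, the difference is a sum of nonnegative terms. *)
    have [w w0 ->] : exists2 w, 0 <= w & alpha * p3 = alpha * N ^+ 3 - w.
      by exists (alpha * N ^+ 3 - alpha * p3); [nra | ring].
    rewrite -subr_ge0; set M := N ^+ 3 in N30 *.
    have -> : 2 * (M - (alpha * M - w)) ^+ 2 -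
      (1 - alpha) * (M ^+ 2 * (1 + alpha ^+ 2) - 2 * M * (alpha * M - w)) =
      (1 - alpha) ^+ 2 * (1 + alpha) * M ^+ 2 + 2 * (1 - alpha) * M * w
      + 2 * w ^+ 2 by ring.
    by do !apply: addr_ge0; do ?apply: mulr_ge0; rewrite ?sqr_ge0 //; lra.
  have -> : \tr T ^+ 2 = nu ^+ 2 * (k0 * (n%:R - alpha ^+ 2)).
    by rewrite trT /k0; ring.
  rewrite qE mulrCA ler_pM2l ?exprn_gt0 // -(ler_pM2l k20) -subr_ge0.
  have -> : k2 * (k0 * (n%:R - alpha ^+ 2)) - k2 * ((n%:R -
      alpha ^+ 2 * (1 + alpha) / 2) * (k0 + 2 * k1 * t + k2 * t ^+ 2)) =
    alpha ^+ 2 / 2 * ((n%:R - alpha ^+ 2) *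
      (2 * (N ^+ 3 - alpha * p3) ^+ 2 - (1 - alpha) * (N ^+ 2 * k2)) +
      alpha ^+ 2 * (1 - alpha) * (N ^+ 3 - alpha * p3) ^+ 2).
    have -> : k2 * ((n%:R - alpha ^+ 2 * (1 + alpha) / 2) *
        (k0 + 2 * k1 * t + k2 * t ^+ 2)) =
      (n%:R - alpha ^+ 2 * (1 + alpha) / 2) *
        (k0 * k2 + 2 * k1 * (k2 * t) + (k2 * t) ^+ 2) by ring.
    by rewrite kt /k0 /k1; field.
  apply: mulr_ge0; first by rewrite divr_ge0 ?sqr_ge0.
  apply: addr_ge0; first by apply: mulr_ge0; [lra | rewrite subr_ge0].
  by do 2 (apply: mulr_ge0; rewrite ?sqr_ge0 //); lra.
split=> //.
have symW s : symmx (W s).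
  rewrite /symmx WE !raddfD /= tr_scalar_mx ![(_ *: _)^T]linearZ /=.
  by rewrite trmx_mul sZ.
have W0 : W 0 = T by rewrite /W scale0r addr0 mul1mx.
(* The criterion [pdmx_of_mxtrace] holds at s = 0 because alpha^2 < 1, hence also at [t], where the
   trace is the same and q is no larger. *)
have q0 : (n%:R - 1) * q 0 < \tr T ^+ 2.
  have -> : q 0 = nu ^+ 2 * k0 by rewrite qE; ring.
  have -> : \tr T ^+ 2 = (n%:R - alpha ^+ 2) * (nu ^+ 2 * k0).
    by rewrite trT /k0; ring.
  by rewrite ltr_pM2r ?mulr_gt0 ?exprn_gt0 //; lra.
have pdT : pdmx T.
  apply: pdmx_of_mxtrace => //; first by rewrite -W0.
  by move: q0; rewrite /q -/(W 0) W0.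
have pdW : pdmx (W t).
  have trW : \tr (W t) = \tr T.
    rewrite trT WE !mxtraceD !mxtraceZ mxtrace_scalar trZ trZZ -mulr_natr; ring.
  apply: pdmx_of_mxtrace => //; rewrite trW //.
  by apply: le_lt_trans q0; rewrite ler_wpM2l ?subr_ge0 //; exact: tmin.
pose f := t / (alpha * nu).
have t0 : 0 <= t by apply: le_trans tge; rewrite divr_ge0 //; lra.
(* [T] is affine in [Z], so I + t Z is affine in [T] and (I + t Z) T has the form c T - f T^2 that
   [pdmx_factor] expects. *)
have E1 : 1%:M + t *: Z = (1 + t * N / alpha)%:M - f *: T.
  apply/matrixP => i j; rewrite !mxE.
  case: (i == j); rewrite ?mulr1n ?mulr0n; rewrite /f; field; lra.
rewrite E1; apply: pdmx_factor => //.
  by rewrite divr_ge0 // mulr_ge0 // ltW.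
by move: pdW; rewrite /W E1 mulmxBl mul_scalar_mx -scalemxAl.
Qed.

(** Split [Z] and [T] into multiples of the identity and traceless parts. The former contribute at
    least alpha N tr T / n; by Cauchy-Schwarz the latter take away at most beta N tr T / n. *)
Lemma mxtrace_mul_ge_at_identity {n : nat} (Z T : 'M[R]_n) (alpha beta N : R) :
  (0 < n)%N -> symmx Z -> symmx T -> 0 <= beta <= alpha -> alpha < 1 ->
  0 <= N -> \tr (Z *m Z) = N ^+ 2 -> alpha * N <= \tr Z ->
  0 <= \tr T -> (n%:R - beta ^+ 2) * \tr (T *m T) <= \tr T ^+ 2 ->
  (alpha - beta) * (\tr T * N / n%:R) <= \tr (Z *m T).
Proof.
move=> n0 sZ sT /andP[b0 ba] a1 N0 trZZ trZ trT0 trTT.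
have n1 : 1 <= n%:R :> R by rewrite ler1n.
have nn0 : n%:R != 0 :> R by lra.
have cen (U V : 'M[R]_n) : \tr ((U - (\tr U / n%:R)%:M) *m
    (V - (\tr V / n%:R)%:M)) = \tr (U *m V) - \tr U * \tr V / n%:R.
  rewrite mulmxBl !mulmxBr !(mul_scalar_mx, mul_mx_scalar) !raddfB /= !mxtraceZ.
  by rewrite mxtrace_scalar -mulr_natr; field.
have sym (U : 'M[R]_n) : symmx U -> (U - (\tr U / n%:R)%:M)^T = U - (\tr U / n%:R)%:M.
  by move=> sU; rewrite raddfB /= tr_scalar_mx sU.
have := mxtrace_CauchySchwarz (Z - (\tr Z / n%:R)%:M) (T - (\tr T / n%:R)%:M).
rewrite !sym // !cen trZZ.
have := mxtrace_mul_tr_ge0 (Z - (\tr Z / n%:R)%:M); rewrite sym // cen trZZ.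
have := mxtrace_mul_tr_ge0 (T - (\tr T / n%:R)%:M); rewrite sym // cen.
move: trZ trT0 trTT; set x := \tr Z; set s := \tr T; set c := \tr (Z *m T).
set d := \tr (T *m T) => xge s0 dle Tge Zge CS.
have bN : beta * N <= x by apply: le_trans xge; rewrite ler_wpM2r.
have bN0 : 0 <= beta * N by rewrite mulr_ge0.
(* Only beta N <= tr Z is used here, so that the factor n - beta^2 matches the one in [Tle]. *)
have Zle : N ^+ 2 - x * x / n%:R <= N ^+ 2 * (n%:R - beta ^+ 2) / n%:R.
  rewrite -subr_ge0.
  have -> : N ^+ 2 * (n%:R - beta ^+ 2) / n%:R - (N ^+ 2 - x * x / n%:R) =
    (x - beta * N) * (x + beta * N) / n%:R by field.
  by rewrite divr_ge0 ?mulr_ge0 //; lra.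
have Tle : (n%:R - beta ^+ 2) * (d - s * s / n%:R) <= (beta * s) ^+ 2 / n%:R.
  rewrite -subr_ge0.
  have -> : (beta * s) ^+ 2 / n%:R - (n%:R - beta ^+ 2) * (d - s * s / n%:R) =
    s ^+ 2 - (n%:R - beta ^+ 2) * d by field.
  by rewrite subr_ge0.
have eb : (c - x * s / n%:R) ^+ 2 <= (beta * N * s / n%:R) ^+ 2.
  apply: (le_trans CS); apply: (le_trans (ler_wpM2r Tge Zle)).
  have -> : N ^+ 2 * (n%:R - beta ^+ 2) / n%:R * (d - s * s / n%:R) =
    N ^+ 2 / n%:R * ((n%:R - beta ^+ 2) * (d - s * s / n%:R)) by ring.
  apply: (le_trans (ler_wpM2l _ Tle)).
    by rewrite divr_ge0 ?sqr_ge0 ?ler0n.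
  rewrite le_eqVlt; apply/orP; left; apply/eqP; by field.
have [bn0 sn0] : 0 <= beta * N * s / n%:R /\ 0 <= s / n%:R.
  by rewrite !divr_ge0 ?ler0n ?mulr_ge0.
have {}eb : - (beta * N * s / n%:R) <= c - x * s / n%:R.
  move: eb bn0; move: (c - _) (beta * N * s / _) => e w ew w0.
  by rewrite leNgt; apply/negP => lt_e; nra.
have := ler_wpM2r sn0 xge.
have -> : (alpha - beta) * (s * N / n%:R) =
  alpha * N * (s / n%:R) - beta * N * s / n%:R by ring.
rewrite -[x * s / _]mulrA in eb; lra.
Qed.

End StepAtIdentity.

(** * Linear constraints and their adjoint *)

Section LinearConstraints.
Context {R : realType} {n m : nat}.
Implicit Types (A : 'I_m -> 'M[R]_n) (X F : 'M[R]_n) (y : 'cV[R]_m).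

Lemma mxvec_mul_tr (U W : 'M[R]_n) :
  (mxvec U *m (mxvec W)^T) 0 0 = \tr (U *m W^T).
Proof.
rewrite mxE mxtrace_mul_tr pair_bigA /= (reindex _ (curry_mxvec_bij _ _)) /=.
by apply: eq_bigr => -[i j] _; rewrite /= mxE !mxvecE.
Qed.

Lemma AopD A X X' : Aop A (X + X') = Aop A X + Aop A X'.
Proof. by apply/colP => i; rewrite !mxE mulmxDr mxtraceD. Qed.

Lemma AopZ A a X : Aop A (a *: X) = a *: Aop A X.
Proof. by apply/colP => i; rewrite !mxE -scalemxAr mxtraceZ. Qed.

Lemma AopN A X : Aop A (- X) = - Aop A X.
Proof. by rewrite -scaleN1r AopZ scaleN1r. Qed.

Lemma mxtrace_Astar A y X : \tr (Astar A y *m X) = bty (Aop A X) y.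
Proof.
rewrite /Astar mulmx_suml raddf_sum /=; apply: eq_bigr => i _.
by rewrite -scalemxAl mxtraceZ mxE mulrC.
Qed.

Lemma Astar0 A : Astar A 0 = 0.
Proof. by rewrite /Astar big1 // => i _; rewrite mxE scale0r. Qed.

(** Membership in the span is tested against the columns of [cokermx M]. Each is symmetrized into an
    admissible direction, which only doubles its pairings with the symmetric [F] and [A i]. *)
Lemma Astar_of_orthogonal A F : symmx F -> (forall i, symmx (A i)) ->
  (forall V, symmx V -> Aop A V = 0 -> \tr (F *m V) = 0) ->
  exists y, F = Astar A y.
Proof.
move=> sF sA orth; pose M := \matrix_i mxvec (A i).
suff /submxP[D FD] : (mxvec F <= M)%MS.
  exists D^T; apply: (can_inj mxvecK); rewrite FD /Astar raddf_sum /=.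
  apply/rowP => k; rewrite mxE summxE; apply: eq_bigr => i _.
  by rewrite linearZ /= !mxE.
have sym2 (U V : 'M[R]_n) : symmx U -> \tr (U *m (V + V^T)) = 2 * \tr (U *m V^T).
  move=> sU; rewrite mulmxDr mxtraceD -[\tr (U *m V)]mxtrace_tr trmx_mul sU.
  by rewrite mxtrace_mulC -mulr2n mulr_natl.
rewrite submxE; apply/eqP/rowP => j.
pose V := vec_mx (col j (cokermx M))^T.
have dotV (U : 'M[R]_n) : \tr (U *m V^T) = (mxvec U *m cokermx M) 0 j.
  by rewrite -mxvec_mul_tr vec_mxK trmxK colE mulmxA -colE mxE.
rewrite [RHS]mxE -dotV; apply: (mulfI (_ : 2 != 0 :> R)); first by rewrite pnatr_eq0.
rewrite mulr0 -sym2 // orth //; first by rewrite /symmx raddfD /= trmxK addrC.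
apply/colP => i; rewrite !mxE sym2 // dotV.
have -> : mxvec (A i) = row i M by rewrite rowK.
by rewrite -row_mul mulmx_coker row0 mxE mulr0.
Qed.

End LinearConstraints.

(** * The inner product at E and its cone *)

Section LocalInnerProduct.
Context {R : realType} {n : nat}.
Implicit Types (E X U V W : 'M[R]_n).

Lemma ipE_sym E U V : ipE E U V = ipE E V U.
Proof. by rewrite /ipE -mulmxA [LHS]mxtrace_mulC !mulmxA. Qed.

Lemma ipEDr E U V W : ipE E U (V + W) = ipE E U V + ipE E U W.
Proof. by rewrite /ipE mulmxDr mxtraceD. Qed.

Lemma ipEZr E U a V : ipE E U (a *: V) = a * ipE E U V.
Proof. by rewrite /ipE -scalemxAr mxtraceZ. Qed.

Lemma ipEDl E U V W : ipE E (V + W) U = ipE E V U + ipE E W U.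
Proof. by rewrite ipE_sym ipEDr !(ipE_sym E U). Qed.

Lemma ipEZl E U a V : ipE E (a *: V) U = a * ipE E V U.
Proof. by rewrite ipE_sym ipEZr ipE_sym. Qed.

Lemma pdmx_unit E : pdmx E -> E \in unitmx.
Proof.
by move=> /pdmx_cholesky[B uB ->]; rewrite unitmx_mul unitmx_tr uB.
Qed.

Lemma invmx_sym E : symmx E -> symmx (invmx E).
Proof. by move=> sE; rewrite /symmx trmx_inv sE. Qed.

Lemma ipE_self E V : pdmx E -> ipE E E V = \tr (invmx E *m V).
Proof. by move=> /pdmx_unit uE; rewrite /ipE mulVmx // mul1mx. Qed.

Lemma mxtrace_invmx_self E : pdmx E -> \tr (invmx E *m E) = n%:R.
Proof. by move=> /pdmx_unit uE; rewrite mulVmx // mxtrace1. Qed.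

Lemma ipE_ge0 E V : pdmx E -> symmx V -> 0 <= ipE E V V.
Proof.
move=> /pdmx_cholesky[B uB ->] sV; rewrite ipE_pcoord //.
by rewrite -[X in _ *m X](pcoord_sym (B := B) _ sV) mxtrace_mul_tr_ge0.
Qed.

Lemma ipE_eq0 E V : pdmx E -> symmx V -> ipE E V V = 0 -> V = 0.
Proof.
move=> /pdmx_cholesky[B uB ->] sV; rewrite ipE_pcoord //.
rewrite -[X in _ *m X](pcoord_sym (B := B) _ sV) => /mxtrace_mul_tr_eq0 V0.
by rewrite -(pcoordK uB V) V0 mulmx0 mul0mx.
Qed.

Lemma ipE_CauchySchwarz E U V : pdmx E -> symmx U -> symmx V ->
  ipE E U V ^+ 2 <= ipE E U U * ipE E V V.
Proof.
move=> /pdmx_cholesky[B uB ->] sU sV; rewrite !ipE_pcoord //.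
have := mxtrace_CauchySchwarz (pcoord (B := B) U) (pcoord (B := B) V).
by rewrite (pcoord_sym _ sU) (pcoord_sym _ sV).
Qed.

Lemma normE_sqr E V : pdmx E -> symmx V -> normE E V ^+ 2 = ipE E V V.
Proof. by move=> pE sV; rewrite sqr_sqrtr // ipE_ge0. Qed.

Lemma normE_ge0 E V : 0 <= normE E V.
Proof. exact: sqrtr_ge0. Qed.

Lemma normE_gt0 E V : pdmx E -> symmx V -> V != 0 -> 0 < normE E V.
Proof.
move=> pE sV V0; rewrite sqrtr_gt0 lt_def ipE_ge0 // andbT.
by apply: contra_neq V0; exact: ipE_eq0.
Qed.

(** Squaring removes the root in [normE], so that small steps and closedness concern polynomial
    inequalities only. *)
Lemma Kcone_sqr E alpha X : pdmx E -> 0 <= alpha ->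
  Kcone E alpha X <-> [/\ symmx X, 0 <= \tr (invmx E *m X) &
    alpha ^+ 2 * ipE E X X <= \tr (invmx E *m X) ^+ 2].
Proof.
move=> pE a0; split=> [[sX leX] | [sX X0 leX]].
  have aN : 0 <= alpha * normE E X by rewrite mulr_ge0 ?normE_ge0.
  split=> //; first exact: le_trans leX.
  by rewrite -normE_sqr // -exprMn ler_sqr ?nnegrE // (le_trans aN).
split=> //; rewrite -ler_sqr ?nnegrE ?mulr_ge0 ?normE_ge0 //.
by rewrite exprMn normE_sqr.
Qed.

End LocalInnerProduct.

(** * First-order optimality over the cone *)

Section OptimalityConditions.
Context {R : realType} {n : nat}.
Implicit Types (E X Y U V W F : 'M[R]_n) (alpha : R).

Lemma small_multiple (p k : R) : 0 < p ->
  exists2 d, 0 < d & forall e, 0 < e <= d -> e * k <= p.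
Proof.
move=> p0; have k0 : 0 < `|k| + 1 by rewrite ltr_pwDr.
exists (p / (`|k| + 1)); first by rewrite divr_gt0.
move=> e /andP[e0]; rewrite ler_pdivlMr // => ek; apply: le_trans ek.
by rewrite ler_wpM2l ?(ltW e0) // (le_trans (ler_norm k)) // lerDl.
Qed.

Lemma small_quadratic_step (a g h c d : R) : 0 <= a -> 0 < a \/ 0 < g -> 0 < c ->
  exists2 e, 0 < e & 0 <= a + 2 * e * g + e ^+ 2 * h /\ 0 <= c + e * d.
Proof.
move=> a0 ag c0; have [d1 d10 hd1] := small_multiple c (- d) c0.
suff [d2 d20 hd2] : exists2 d2, 0 < d2 &
    forall e, 0 < e <= d2 -> 0 <= a + 2 * e * g + e ^+ 2 * h.
  exists (Num.min d1 d2); first by rewrite lt_min d10.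
  have m0 : 0 < Num.min d1 d2 by rewrite lt_min d10.
  split; first by apply: hd2; rewrite m0 ge_min lexx orbT.
  by have := hd1 (Num.min d1 d2); rewrite m0 ge_min lexx => /(_ isT); lra.
case: ag => [{}a0 | g0].
  have [d2 d20 hd2] := small_multiple a (- (2 * g) + `|h|) a0.
  exists (Num.min d2 1) => [|e]; first by rewrite lt_min d20 ltr01.
  rewrite le_min => /andP[e0 /andP[ed e1]].
  have := hd2 e; rewrite e0 ed => /(_ isT) => ea.
  have hN : - `|h| <= h by rewrite lerNl -normrN ler_norm.
  have h0 := normr_ge0 h.
  have e2h : - (e * `|h|) <= e ^+ 2 * h.
    apply: le_trans (_ : e ^+ 2 * - `|h| <= _); last by rewrite ler_wpM2l ?sqr_ge0.
    rewrite mulrN lerN2 ler_wpM2r //; nra.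
  lra.
have [d2 d20 hd2] := small_multiple (2 * g) (- h) (mulr_gt0 (ltr0n _ 2) g0).
exists d2 => // e ed; have := hd2 e ed; case/andP: ed => e0 _ eh.
have : e * (e * - h) <= e * (2 * g) by rewrite ler_wpM2l // ltW.
lra.
Qed.

(** Half the gradient at [X], for the trace inner product, of tr (E^-1 X)^2 - alpha^2 |X|_E^2. *)
Definition Kgrad E alpha X : 'M[R]_n :=
  \tr (invmx E *m X) *: invmx E - alpha ^+ 2 *: (invmx E *m X *m invmx E).

Lemma mxtrace_Kgrad E alpha X V : \tr (Kgrad E alpha X *m V) =
  \tr (invmx E *m X) * \tr (invmx E *m V) - alpha ^+ 2 * ipE E X V.
Proof. by rewrite /Kgrad mulmxBl -!scalemxAl raddfB /= !mxtraceZ. Qed.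

Lemma Kgrad_sym E alpha X : symmx E -> symmx X -> symmx (Kgrad E alpha X).
Proof.
move=> sE sX; rewrite /symmx /Kgrad raddfB /= ![(_ *: _)^T]linearZ /=.
by rewrite !trmx_mul (invmx_sym _ sE) sX mulmxA.
Qed.

Lemma Kcone_mxtrace_gt0 E alpha X : pdmx E -> 0 < alpha -> Kcone E alpha X ->
  X != 0 -> 0 < \tr (invmx E *m X).
Proof.
by move=> pE a0 [sX]; move/lt_le_trans => h X0; apply: h; rewrite mulr_gt0 // normE_gt0.
Qed.

(** Along X + e V the squared cone inequality is a quadratic in e with value [a] and slope 2 tr
    (Kgrad V) at 0; one of them is positive. *)
Lemma Kcone_direction E alpha X V : pdmx E -> 0 < alpha -> Kcone E alpha X ->
  X != 0 -> symmx V ->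
  alpha * normE E X < \tr (invmx E *m X) \/ 0 < \tr (Kgrad E alpha X *m V) ->
  exists2 e, 0 < e & Kcone E alpha (X + e *: V).
Proof.
move=> pE a0 KX X0 sV hV; have tau0 := Kcone_mxtrace_gt0 _ _ _ pE a0 KX X0.
have [sX _ leX] := (Kcone_sqr _ _ _ pE (ltW a0)).1 KX.
set tau := \tr (invmx E *m X) in tau0 hV leX.
pose a := tau ^+ 2 - alpha ^+ 2 * ipE E X X.
have a0' : 0 <= a by rewrite subr_ge0.
have hV' : 0 < a \/ 0 < \tr (Kgrad E alpha X *m V).
  case: hV => [ltX|]; [left | by right].
  rewrite subr_gt0 -normE_sqr // -exprMn ltr_sqr ?nnegrE ?mulr_ge0 ?normE_ge0 //.
    exact: ltW.
  exact: ltW.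
have [e e0 [q0 t0]] := small_quadratic_step a _
  (\tr (invmx E *m V) ^+ 2 - alpha ^+ 2 * ipE E V V) tau
  (\tr (invmx E *m V)) a0' hV' tau0.
exists e => //; apply/(Kcone_sqr _ _ _ pE (ltW a0)).
rewrite mulmxDr -scalemxAr mxtraceD mxtraceZ -/tau; split=> //.
  by rewrite /symmx raddfD /= linearZ /= sX sV.
rewrite -subr_ge0 !(ipEDl, ipEDr, ipEZl, ipEZr) (ipE_sym E V X).
move: q0; rewrite mxtrace_Kgrad -/tau /a; congr (0 <= _); ring.
Qed.

(** A multiplier rule by feasible directions. In the interior every direction and its opposite are
    feasible, which would put [F] in the span of the [A i]. On the boundary, tangent directions
    become feasible after a small tilt towards [E], so on the kernel of [Aop A] the form [F] is a
    multiple of the gradient. *)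
Lemma QP_stationarity {m : nat} E alpha (A : 'I_m -> 'M[R]_n) X F :
  pdmx E -> 0 < alpha -> alpha ^+ 2 < n%:R -> symmx F ->
  (forall i, symmx (A i)) -> Kcone E alpha X -> X != 0 -> Aop A E = Aop A X ->
  (forall Y, Kcone E alpha Y -> Aop A Y = Aop A X ->
    \tr (F *m X) <= \tr (F *m Y)) ->
  ~ (exists y, F = Astar A y) ->
  \tr (invmx E *m X) = alpha * normE E X /\
  exists y lam, 0 < lam /\ F = Astar A y + lam *: Kgrad E alpha X.
Proof.
move=> pE a0 an sF sA KX X0 AE minX FA; have [sX leX] := KX.
have tau0 := Kcone_mxtrace_gt0 _ _ _ pE a0 KX X0.
have descent V : symmx V -> Aop A V = 0 ->
    alpha * normE E X < \tr (invmx E *m X) \/ 0 < \tr (Kgrad E alpha X *m V) ->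
    0 <= \tr (F *m V).
  move=> sV AV hV; have [e e0 KV] := Kcone_direction _ _ _ _ pE a0 KX X0 sV hV.
  have := minX _ KV; rewrite AopD AopZ AV scaler0 addr0 => /(_ erefl).
  by rewrite mulmxDr -scalemxAr mxtraceD mxtraceZ lerDl pmulr_rge0.
have tauE : \tr (invmx E *m X) = alpha * normE E X.
  apply/eqP; rewrite eq_le leX andbT leNgt; apply/negP => ltX; apply: FA.
  apply: Astar_of_orthogonal => // V sV AV; apply/eqP; rewrite eq_le.
  rewrite (descent V) ?andbT //; last by left.
  rewrite -oppr_ge0 -raddfN /= -mulmxN; apply: descent; last by left.
    by rewrite /symmx raddfN /= sV.
  by rewrite AopN AV oppr0.
split=> //; set g := fun V => \tr (Kgrad E alpha X *m V).
(* On the boundary this equals (n - alpha^2) tr (E^-1 X), so E - X points strictly into the cone. *)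
have gE : 0 < g (E - X).
  rewrite /g mxtrace_Kgrad mulmxBr raddfB /= mxtrace_invmx_self //.
  have -> : ipE E X (E - X) = \tr (invmx E *m X) - ipE E X X.
    by rewrite -scaleN1r ipEDr ipEZr mulN1r ipE_sym ipE_self.
  have nX : \tr (invmx E *m X) ^+ 2 = alpha ^+ 2 * ipE E X X.
    by rewrite tauE exprMn normE_sqr.
  move: tau0 nX; move: (\tr _) (ipE _ _ _) => tau p tau0 nX.
  have -> : tau * (n%:R - tau) - alpha ^+ 2 * (tau - p) =
    (n%:R - alpha ^+ 2) * tau - (tau ^+ 2 - alpha ^+ 2 * p) by ring.
  by rewrite nX subrr subr0 mulr_gt0 // subr_gt0.
have sV0 : symmx (E - X) by rewrite /symmx raddfB /= sX; case: pE => ->.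
have AV0 : Aop A (E - X) = 0 by rewrite AopD AopN AE subrr.
have gD V W a : g (V + a *: W) = g V + a * g W.
  by rewrite /g mulmxDr -scalemxAr mxtraceD mxtraceZ.
have fD V W a : \tr (F *m (V + a *: W)) = \tr (F *m V) + a * \tr (F *m W).
  by rewrite mulmxDr -scalemxAr mxtraceD mxtraceZ.
have f0 : 0 <= \tr (F *m (E - X)) by apply: descent => //; right.
have tangent V : symmx V -> Aop A V = 0 -> g V = 0 -> 0 <= \tr (F *m V).
  move=> sV AV gV; rewrite leNgt; apply/negP => ltV.
  pose e := - \tr (F *m V) / (\tr (F *m (E - X)) + 1) / 2.
  have e0 : 0 < e by rewrite !divr_gt0 ?oppr_gt0 // ltr_wpDl.
  have : 0 <= \tr (F *m (V + e *: (E - X))).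
    apply: descent; first by rewrite /symmx raddfD /= linearZ /= sV sV0.
      by rewrite AopD AopZ AV AV0 scaler0 addr0.
    by right; rewrite -/(g _) gD gV add0r mulr_gt0.
  rewrite fD.
  have : e * (2 * (\tr (F *m (E - X)) + 1)) = - \tr (F *m V).
    by rewrite /e; field; lra.
  nra.
pose lam := \tr (F *m (E - X)) / g (E - X).
have FV V : symmx V -> Aop A V = 0 -> \tr (F *m V) = lam * g V.
  (* Adding [c] times E - X makes [V] tangent; [tangent] in both signs then gives equality. *)
  move=> sV AV; pose c := - (g V / g (E - X)).
  have gn0 : g (E - X) != 0 by rewrite gt_eqF.
  have gV' : g (V + c *: (E - X)) = 0.
    by rewrite gD /c mulNr divfK // subrr.
  have sV' : symmx (V + c *: (E - X)) by rewrite /symmx raddfD /= linearZ /= sV sV0.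
  have AV' : Aop A (V + c *: (E - X)) = 0 by rewrite AopD AopZ AV AV0 scaler0 addr0.
  have ge := tangent _ sV' AV' gV'.
  have le : 0 <= \tr (F *m - (V + c *: (E - X))).
    apply: tangent; first by rewrite /symmx raddfN /= sV'.
      by rewrite AopN AV' oppr0.
    by rewrite /g mulmxN raddfN /= -/(g _) gV' oppr0.
  move: le ge; rewrite mulmxN raddfN /= oppr_ge0 fD => le ge.
  have /eqP : \tr (F *m V) + c * \tr (F *m (E - X)) = 0.
    by apply/eqP; rewrite eq_le le ge.
  rewrite addr_eq0 => /eqP ->; rewrite /c /lam; ring.
have [||V sV AV|y Fy] := Astar_of_orthogonal A (F - lam *: Kgrad E alpha X).
- rewrite /symmx raddfB /= linearZ /= sF Kgrad_sym //; by case: pE.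
- exact: sA.
- by rewrite mulmxBl -scalemxAl raddfB /= mxtraceZ FV // subrr.
exists y, lam; split; last by rewrite -Fy subrK.
rewrite lt_def divr_ge0 ?(ltW gE) // andbT.
by apply/eqP => lam0; apply: FA; exists y; rewrite -Fy lam0 scale0r subr0.
Qed.

(** On the boundary the pairing with [Y] is at least alpha^2 (|X| |Y| - <X, Y>) in the geometry of
    [E], nonnegative by Cauchy-Schwarz. *)
Lemma Kgrad_Kdual E alpha X : pdmx E -> 0 < alpha -> Kcone E alpha X ->
  \tr (invmx E *m X) = alpha * normE E X -> Kdual E alpha (Kgrad E alpha X).
Proof.
move=> pE a0 [sX leX] tauE; split=> [|Y [sY leY]].
  by apply: Kgrad_sym => //; case: pE.
rewrite mxtrace_mulC mxtrace_Kgrad tauE subr_ge0.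
apply: le_trans (_ : alpha * normE E X * (alpha * normE E Y) <= _); last first.
  by rewrite ler_wpM2l // mulr_ge0 ?normE_ge0 // ltW.
rewrite mulrACA -expr2 ler_wpM2l ?sqr_ge0 //.
have := ipE_CauchySchwarz E X Y pE sX sY; rewrite -!normE_sqr // -exprMn => CS.
have N0 : 0 <= normE E X * normE E Y by rewrite mulr_ge0 ?normE_ge0.
by rewrite leNgt; apply/negP => lt; nra.
Qed.

End OptimalityConditions.

(** * Attainment of the cone program *)

Section Attainment.
Local Open Scope classical_set_scope.
Local Open Scope ring_scope.
Context {R : realType}.

Lemma continuous_bigsum {T : topologicalType} {I : finType} (F : I -> T -> R) :
  (forall i, continuous (F i)) -> continuous (fun v => \sum_i F i v).
Proof.
move=> cF; have -> : (fun v => \sum_i F i v) = \sum_i F i.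
  by apply/funext => v; rewrite fct_sumE.
elim/big_ind: _ => [|f g cf cg|i _]; last exact: cF.
  exact: cst_continuous.
by move=> x; apply: continuousD; [exact: cf | exact: cg].
Qed.

Lemma continuous_mxtrace_mul {T : topologicalType} {n : nat}
    (F G : T -> 'M[R]_n) :
  (forall i j, continuous (fun v => F v i j)) ->
  (forall i j, continuous (fun v => G v i j)) ->
  continuous (fun v => \tr (F v *m G v)).
Proof.
move=> cF cG; rewrite /mxtrace; apply: continuous_bigsum => i.
have -> : (fun v => (F v *m G v) i i) = (fun v => \sum_k F v i k * G v k i).
  by apply/funext => v; rewrite mxE.
apply: continuous_bigsum => k x.
by apply: continuousM; [exact: cF | exact: cG].
Qed.

Lemma closed_preimage {T : topologicalType} (f : T -> R) (P : set R) :
  continuous f -> closed P -> closed (fun v => P (f v)).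
Proof. by move=> cf cP; apply: (closed_comp _ cP) => x _; exact: cf. Qed.

(** On feasible points the objective is tr (X S) plus a constant, and coercivity bounds the sublevel
    set of tr (X S) through [E]. Its coordinates, flattened to row vectors, form the compact set
    [D]. *)
Lemma QPopt_exists {n m : nat} (C : 'M[R]_n) (A : 'I_m -> 'M[R]_n)
    (b y : 'cV[R]_m) (E S : 'M[R]_n) (alpha eps : R) :
  pdmx E -> 0 <= alpha -> alpha ^+ 2 <= n%:R -> Aop A E = b ->
  Astar A y + S = C -> 0 < eps ->
  (forall X, Kcone E alpha X -> eps * normE E X <= \tr (X *m S)) ->
  exists X, QPopt C A b E alpha X.
Proof.
move=> pE a0 an AE defC eps0 coer.
have CE X : Aop A X = b -> \tr (C *m X) = bty b y + \tr (X *m S).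
  by move=> AX; rewrite -defC mulmxDl mxtraceD mxtrace_Astar AX (mxtrace_mulC S).
have [B uB defE] := pdmx_cholesky E pE.
pose T := dcoord (B := B) S; pose X Z := B *m Z *m B^T.
have trX Z M : \tr (X Z *m M) = \tr (Z *m dcoord (B := B) M).
  by rewrite (mxtrace_mul_coord uB) /X pcoordKV.
have trXS Z : \tr (X Z *m S) = \tr (Z *m T) by rewrite trX.
have trES : \tr (E *m S) = \tr (1%:M *m T).
  by rewrite defE mxtrace_dcoord // mul1mx.
have KX Z : Kcone E alpha (X Z) <->
    [/\ symmx Z, 0 <= \tr (Z *m 1%:M) & 
      0 <= \tr (Z *m 1%:M) * \tr (Z *m 1%:M) - alpha ^+ 2 * \tr (Z *m Z)].
  rewrite (Kcone_sqr _ _ _ pE a0) mulmx1 -expr2 subr_ge0 defE mxtrace_pcoord // ipE_pcoord //.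
  rewrite !pcoordKV //; split=> -[sZ h1 h2]; split=> //.
    by rewrite -(pcoordKV uB Z); exact: pcoord_sym.
  by rewrite /symmx /X !trmx_mul trmxK sZ mulmxA.
have AX Z i : Aop A (X Z) i 0 = \tr (Z *m dcoord (B := B) (A i)).
  by rewrite mxE [LHS]mxtrace_mulC trX.
pose D : set 'rV[R]_(n * n) := [set v | [/\ QPfeas A b E alpha (X (vec_mx v))
  & \tr (vec_mx v *m T) <= \tr (1%:M *m T)]].
have cZ i j : continuous (fun v : 'rV[R]_(n * n) => (vec_mx v : 'M[R]_n) i j).
  have -> : (fun v : 'rV[R]_(n * n) => (vec_mx v : 'M[R]_n) i j) =
    (fun v => v 0 (mxvec_index i j)) by apply/funext => v; rewrite mxE.
  exact: coord_continuous.
have ccst (M : 'M[R]_n) i j : continuous (fun _ : 'rV[R]_(n * n) => M i j).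
  exact: cst_continuous.
have ctr M : continuous (fun v : 'rV[R]_(n * n) => \tr (vec_mx v *m M)).
  by apply: continuous_mxtrace_mul.
have D1 : D (mxvec 1%:M).
  rewrite /D /= mxvecK; split=> //; rewrite /X mulmx1 -defE; split=> //.
  apply/(Kcone_sqr _ _ _ pE a0); rewrite ipE_self // mxtrace_invmx_self //.
  split; [by case: pE | by rewrite ler0n | by rewrite expr2 ler_wpM2r ?ler0n].
have closedD : closed D.
  have -> : D = (\bigcap_i (fun v => \tr (vec_mx v *m dcoord (B := B) (A i)) = b i 0))
    `&` ((\bigcap_i \bigcap_j (fun v => (vec_mx v : 'M[R]_n) i j - (vec_mx v : 'M[R]_n) j i = 0))
    `&` ((fun v => 0 <= \tr (vec_mx v *m 1%:M))
    `&` ((fun v => 0 <= \tr (vec_mx v *m 1%:M) * \tr (vec_mx v *m 1%:M)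
        - alpha ^+ 2 * \tr (vec_mx v *m vec_mx v))
    `&` (fun v => \tr (vec_mx v *m T) <= \tr (1%:M *m T))))).
    apply/seteqP; split=> v /=.
      move=> [[Av /KX[sv v0 v1]] v2]; split; first by move=> i _; rewrite /= -AX Av.
      split=> // i _ j _ /=; apply/eqP; rewrite subr_eq0; apply/eqP.
      by rewrite -{1}sv mxE.
    move=> [Av [sv [v0 [v1 v2]]]]; split=> //; split.
      by apply/colP => i; rewrite AX; exact: Av.
    apply/KX; split=> //; apply/matrixP => i j; rewrite mxE.
    by apply/eqP; rewrite -subr_eq0; apply/eqP; exact: sv.
  apply: closedI.
    by apply: closed_bigI => i _; apply: (closed_preimage _ (fun x => x = b i 0));
      [exact: ctr | exact: closed_eq].
  apply: closedI.
    apply: closed_bigI => i _; apply: closed_bigI => j _.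
    apply: (closed_preimage _ (fun x => x = 0)); last exact: closed_eq.
    by move=> x; exact: (cvgB (cZ i j x) (cZ j i x)).
  apply: closedI.
    by apply: (closed_preimage _ (fun x => 0 <= x)); [exact: ctr | exact: closed_ge].
  apply: closedI.
    apply: (closed_preimage _ (fun x => 0 <= x)); last exact: closed_ge.
    have cZZ := continuous_mxtrace_mul _ _ cZ cZ.
    move=> x; exact: (cvgB (cvgM (ctr 1%:M x) (ctr 1%:M x))
      (cvgM (@cst_continuous _ R (alpha ^+ 2) x) (cZZ x))).
  by apply: (closed_preimage _ (fun x => x <= _)); [exact: ctr | exact: closed_le].
have compactD : compact D.
  pose M := \tr (1%:M *m T) / eps.
  apply: (subclosed_compact closedD (rV_compact (fun _ => @segment_compact R (- M) M))).
  move=> v [[Av Kv] v2] k /=; rewrite in_itv /= -ler_norml.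
  have N0 := normE_ge0 E (X (vec_mx v)).
  apply: (@le_trans _ _ (normE E (X (vec_mx v)))); last first.
    by rewrite ler_pdivlMr // mulrC; apply: le_trans (coer _ Kv) _; rewrite trXS.
  rewrite -ler_sqr ?nnegrE // -normrX ger0_norm ?sqr_ge0 // normE_sqr //; last by case: Kv.
  rewrite defE ipE_pcoord // pcoordKV //; case/KX: Kv => sv _ _.
  rewrite -[X in _ *m X]sv; case/mxvec_indexP: k => i j.
  by have := sqr_entry_le_mxtrace (vec_mx v) i j; rewrite mxE.
have cD : {within D, continuous (fun v : 'rV[R]_(n * n) => \tr (vec_mx v *m T))}.
  by apply: continuous_subspaceT; exact: ctr.
have [v] := compact_EVT_min (ex_intro _ _ D1) compactD cD.
rewrite inE => -[Fv v2] vmin; exists (X (vec_mx v)); split=> // X' FX'.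
rewrite !CE ?(proj1 Fv) ?(proj1 FX') // lerD2l trXS.
(* A competitor outside the sublevel set is no better than [E], hence no better than the
   minimizer. *)
have [leX'|/ltW geX'] := leP (\tr (X' *m S)) (\tr (E *m S)).
  have X'K : X (pcoord (B := B) X') = X' by rewrite /X pcoordK.
  have := vmin (mxvec (pcoord (B := B) X')); rewrite mxvecK -(trXS (pcoord X')) X'K.
  by apply; rewrite inE /D /= mxvecK -trXS X'K -trES.
by apply: le_trans geX'; rewrite trES.
Qed.

End Attainment.

(** * The update and its properties *)

Section AffineScalingStep.
Context {R : realType} {n : nat}.
Implicit Types (E X S : 'M[R]_n) (alpha beta : R).

Lemma mxtrace_mul_ge E S X alpha beta : (0 < n)%N -> pdmx E -> symmx S ->
  0 <= beta <= alpha -> alpha < 1 -> Kcone E alpha X -> 0 <= \tr (E *m S) ->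
  (n%:R - beta ^+ 2) * \tr (E *m S *m (E *m S)) <= \tr (E *m S) ^+ 2 ->
  (alpha - beta) * (\tr (E *m S) * normE E X / n%:R) <= \tr (X *m S).
Proof.
move=> n0 pE sS b a1 [sX KX]; have [B uB defE] := pdmx_cholesky E pE.
have nX := normE_sqr _ _ pE sX; move: KX nX.
rewrite defE mxtrace_dcoord (mxtrace_mul4_coord uB) mxtrace_pcoord //.
rewrite ipE_pcoord // pcoord_self // mul1mx (mxtrace_mul_coord uB X S).
move=> KX nX; apply: mxtrace_mul_ge_at_identity => //.
- exact: pcoord_sym.
- exact: dcoord_sym.
- exact: normE_ge0.
Qed.

(* The parameter beta such that, after a step, the old dual slack lies in the
   dual of the cone K_E'(beta), which contains K_E'(alpha). *)
Definition wide alpha : R := Num.sqrt (alpha ^+ 2 * (1 + alpha) / 2).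

Lemma wide_sqr alpha : 0 < alpha -> wide alpha ^+ 2 = alpha ^+ 2 * (1 + alpha) / 2.
Proof.
move=> a0; rewrite sqr_sqrtr // divr_ge0 // mulr_ge0 ?sqr_ge0 //; lra.
Qed.

Lemma wide_ge0 alpha : 0 <= wide alpha.
Proof. exact: sqrtr_ge0. Qed.

(** With d = alpha (1 - alpha) / 4, the square of [wide alpha] is alpha^2 - 2 alpha d = (alpha -
    d)^2 - d^2. *)
Lemma wide_gap alpha : 0 < alpha < 1 -> alpha * (1 - alpha) / 4 <= alpha - wide alpha.
Proof.
move=> /andP[a0 a1]; rewrite lerBrDr -lerBrDl -ler_sqr ?nnegrE ?wide_ge0 //; last nra.
rewrite wide_sqr // -subr_ge0.
have -> : (alpha - alpha * (1 - alpha) / 4) ^+ 2 - alpha ^+ 2 * (1 + alpha) / 2 =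
  (alpha * (1 - alpha) / 4) ^+ 2 by field.
exact: sqr_ge0.
Qed.

Lemma kappa_gt0 alpha : 0 < alpha < 1 -> 0 < kappa alpha.
Proof.
move=> /andP[a0 a1]; rewrite mulr_gt0 // sqrtr_gt0 divr_gt0 //; lra.
Qed.

Lemma kappa_sqr alpha : alpha < 1 -> kappa alpha ^+ 2 = alpha ^+ 2 * (1 - alpha) / 8.
Proof.
move=> a1; rewrite exprMn sqr_sqrtr ?mulrA // divr_ge0 //; lra.
Qed.

Context {m : nat} {C : 'M[R]_n} {A : 'I_m -> 'M[R]_n} {b : 'cV[R]_m} {alpha : R}.
Context (std : standing C A b) (a01 : 0 < alpha < 1).

(** In dimension 0, [C] would be the trivial combination of the [A i]. *)
Lemma standing_dim_gt0 : (0 < n)%N.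
Proof.
case: std => _ [_ [_ [_ [_ [CA _]]]]]; rewrite lt0n; apply/eqP => n0; apply: CA.
exists 0; rewrite Astar0; apply/matrixP => i j.
by have := leq_trans (ltn_ord i) (eq_leq n0).
Qed.

Lemma sqr_alpha_lt_dim : alpha ^+ 2 < n%:R.
Proof.
apply: (@lt_le_trans _ _ 1); last by rewrite ler1n standing_dim_gt0.
by case/andP: a01 => a0 a1; nra.
Qed.

Lemma dual_decomp X y S : Aop A X = b -> Astar A y + S = C ->
  \tr (C *m X) = bty b y + \tr (X *m S).
Proof. by move=> AX <-; rewrite mulmxDl mxtraceD mxtrace_Astar AX (mxtrace_mulC S). Qed.

(** Stationarity for [C] yields a dual feasible slack orthogonal to [X]; its value forces tr (X S) =
    0 for any dual optimal [S]. Then [X] minimizes the pairing with [S] over the whole cone, and a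
    second use of stationarity makes this [S] a multiple of the gradient. *)
Lemma complementary_slackness E X y S : pdmx E -> Aop A E = b ->
  QPopt C A b E alpha X -> QPDopt C A b E alpha y S ->
  [/\ \tr (X *m S) = 0, X != 0, \tr (invmx E *m X) = alpha * normE E X &
    exists2 lam, 0 < lam & S = lam *: Kgrad E alpha X].
Proof.
move=> pE AE [[AX KX] minX] [[defC KS] maxy].
have [sC [sA [_ [_ [b0 [CA _]]]]]] := std; have /andP[a0 a1] := a01.
have X0 : X != 0.
  apply: contra_neq b0 => X0; rewrite -AX X0; apply/colP => i.
  by rewrite !mxE mulmx0 mxtrace0.
have AEX : Aop A E = Aop A X by rewrite AE AX.
have [|tauE [y1 [lam [lam0 CE]]]] := QP_stationarity E alpha A X C pE a0
  sqr_alpha_lt_dim sC sA KX X0 AEX _ CA.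
  by move=> Y KY AY; apply: minX; split=> //; rewrite AY.
have KG := Kgrad_Kdual _ _ _ pE a0 KX tauE.
have le1 : bty b y1 <= bty b y.
  apply: (maxy _ (lam *: Kgrad E alpha X)); split=> //; case: KG => sG Gpos; split.
    by rewrite /symmx linearZ /= sG.
  by move=> Y KY; rewrite -scalemxAr mxtraceZ mulr_ge0 ?(ltW lam0) ?Gpos.
have XS0 : \tr (X *m S) = 0.
  apply/eqP; rewrite eq_le (proj2 KS) // andbT.
  have := dual_decomp _ _ _ AX defC; rewrite (dual_decomp _ _ _ AX (esym CE)).
  have -> : \tr (X *m (lam *: Kgrad E alpha X)) = 0.
    rewrite -scalemxAr mxtraceZ mxtrace_mulC mxtrace_Kgrad tauE.
    by rewrite -normE_sqr //; [ring | case: KX].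
  lra.
(* An empty family of constraints restricts [QP_stationarity] to the cone alone; its last premise
   becomes S <> 0. *)
split=> //; pose A0 (i : 'I_0) : 'M[R]_n := 0.
have Astar00 (z : 'cV[R]_0) : Astar A0 z = 0 by rewrite /Astar big_ord0.
have A00 (U V : 'M[R]_n) : Aop A0 U = Aop A0 V by apply/colP => -[].
have sA0 (i : 'I_0) : symmx (A0 i) by case: i.
have [|| _ [y2 [lam2 [lam20 SE]]]] := QP_stationarity E alpha A0 X S pE a0
  sqr_alpha_lt_dim (proj1 KS) sA0 KX X0 (A00 _ _).
- by move=> Y KY _; rewrite !(mxtrace_mulC S) XS0 (proj2 KS).
- case=> z S0; apply: CA; exists y; rewrite -defC S0 Astar00 addr0 //.
by exists lam2 => //; rewrite SE Astar00 add0r.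
Qed.

Lemma step_facts E X y S t : pdmx E -> Aop A E = b ->
  QPopt C A b E alpha X -> QPDopt C A b E alpha y S ->
  (forall s, tquad E X S t <= tquad E X S s) ->
  [/\ 0 < normE E X, alpha / (2 * normE E X) <= t, 0 < \tr (E *m S),
      pdmx (update E X t) &
   [/\ Aop A (update E X t) = b,
      \tr (update E X t *m S) = \tr (E *m S) / (1 + t) &
      (n%:R - wide alpha ^+ 2) * \tr (update E X t *m S *m (update E X t *m S))
        <= \tr (update E X t *m S) ^+ 2]].
Proof.
move=> pE AE optX opty tmin.
have [XS0 X0 tauE [lam lam0 SE]] := complementary_slackness _ _ _ _ pE AE optX opty.
have [[AX [sX _]] _] := optX; have /andP[a0 a1] := a01.
have N0 := normE_gt0 _ _ pE sX X0; have nX := normE_sqr _ _ pE sX.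
have n0 := standing_dim_gt0.
have [B uB defE] := pdmx_cholesky E pE.
(* As tr (E^-1 X) = alpha N, lam times the gradient reads lam alpha (N I - alpha Z) in
   coordinates. *)
pose N := normE E X; pose Z := pcoord (B := B) X; pose nu := lam * alpha.
have TE : dcoord (B := B) S = nu *: (N%:M - alpha *: Z).
  rewrite SE /Kgrad tauE -/N defE invmx_gram // /dcoord.
  set P := invmx B; have PB : P *m B = 1%:M by rewrite mulVmx.
  have BP : B^T *m P^T = 1%:M by rewrite -trmx_mul PB trmx1.
  have d1 : B^T *m (P^T *m P) *m B = 1%:M by rewrite mulmxA BP mul1mx.
  have d2 : B^T *m (P^T *m P *m X *m (P^T *m P)) *m B = Z.
    by rewrite !mulmxA BP mul1mx -mulmxA PB mulmx1.
  rewrite -!scalemxAr -!scalemxAl mulmxBr mulmxBl -!scalemxAr -!scalemxAl d1 d2.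
  rewrite -[N%:M]scalemx1.
  apply/matrixP => i j; rewrite !mxE /nu; ring.
have := step_at_identity Z alpha nu N t; rewrite -TE.
have tq s : \tr ((1%:M + s *: Z) *m dcoord (B := B) S
    *m ((1%:M + s *: Z) *m dcoord (B := B) S)) = tquad E X S s.
  by rewrite defE (tquad_coord uB).
case=> //.
- by rewrite mulr_gt0.
- exact: pcoord_sym.
- by rewrite -tauE defE mxtrace_pcoord.
- by rewrite nX defE ipE_pcoord.
- by move=> s; rewrite !tq.
move=> tge qt trT pdt; rewrite tq in qt.
rewrite -mxtrace_dcoord -defE // in qt trT.
have t0 : 0 < t by apply: lt_le_trans tge; rewrite divr_gt0 // mulr_gt0.
have t10 : 1 + t != 0 by rewrite gt_eqF // addr_gt0.
have trE : \tr (update E X t *m S) = \tr (E *m S) / (1 + t).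
  rewrite /update -scalemxAl mxtraceZ mulmxDl -scalemxAl mxtraceD mxtraceZ XS0.
  by rewrite mulr0 addr0 mulrC.
split=> //.
  have [sEt pEt] : pdmx (E + t *: X).
    have -> : E + t *: X = B *m (1%:M + t *: Z) *m B^T.
      by rewrite mulmxDr mulmxDl mulmx1 -defE -scalemxAr -scalemxAl pcoordK.
    exact: pdmx_congr.
  split; first by rewrite /symmx linearZ /= sEt.
  move=> x x0; rewrite -scalemxAr -scalemxAl mxE mulr_gt0 ?pEt //.
  by rewrite invr_gt0 addr_gt0.
split=> //.
  rewrite /update AopZ AopD AopZ AE AX -{1}[b]scale1r -scalerDl scalerA.
  by rewrite mulVf // scale1r.
rewrite trE /update -!scalemxAl -scalemxAr !mxtraceZ wide_sqr //.
have -> : (\tr (E *m S) / (1 + t)) ^+ 2 = ((1 + t)^-1) ^+ 2 * \tr (E *m S) ^+ 2 by ring.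
by rewrite mulrA -expr2 mulrCA ler_pM2l ?exprn_gt0 ?invr_gt0 ?addr_gt0.
Qed.

Lemma gapE_dual E y S : Aop A E = b -> Astar A y + S = C ->
  gapE C b E y = \tr (E *m S).
Proof. by move=> AE defC; rewrite /gapE (dual_decomp _ _ _ AE defC) addrC addKr. Qed.

(** A bound linear in the norm of [Y] gives coercivity of the new problem, dual feasibility of the
    old pair, and later the dual gain. *)
Lemma step_Kdual E X y S t : pdmx E -> Aop A E = b ->
  QPopt C A b E alpha X -> QPDopt C A b E alpha y S ->
  (forall s, tquad E X S t <= tquad E X S s) ->
  forall Y, Kcone (update E X t) alpha Y ->
  (alpha - wide alpha) * (\tr (update E X t *m S) * normE (update E X t) Y / n%:R)
    <= \tr (Y *m S).
Proof.
move=> pE AE optX opty tmin Y KY.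
have [N0 tge ES0 pE' [AE' trE' wE']] := step_facts _ _ _ _ _ pE AE optX opty tmin.
have /andP[a0 a1] := a01; have := wide_gap _ a01.
have [[_ [sS _]] _] := opty.
have t0 : 0 < t by apply: lt_le_trans tge; rewrite divr_gt0 // mulr_gt0.
move=> wg; apply: mxtrace_mul_ge => //; first exact: standing_dim_gt0.
  by rewrite wide_ge0 /=; nra.
by rewrite trE' divr_ge0 ?(ltW ES0) // addr_ge0 // ltW.
Qed.

Lemma step_improves E X y S t : pdmx E -> Aop A E = b ->
  QPopt C A b E alpha X -> QPDopt C A b E alpha y S ->
  (forall s, tquad E X S t <= tquad E X S s) ->
  [/\ Swath C A b alpha (update E X t),
      \tr (C *m update E X t) < \tr (C *m E) &
      forall y' S', QPDopt C A b (update E X t) alpha y' S' -> bty b y <= bty b y'].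
Proof.
move=> pE AE optX opty tmin.
have KS := step_Kdual _ _ _ _ _ pE AE optX opty tmin.
have [N0 tge ES0 pE' [AE' trE' wE']] := step_facts _ _ _ _ _ pE AE optX opty tmin.
have /andP[a0 a1] := a01; have wg := wide_gap _ a01.
have [[defC [sS _]] _] := opty.
have t0 : 0 < t by apply: lt_le_trans tge; rewrite divr_gt0 // mulr_gt0.
have nR0 : 0 < n%:R :> R by rewrite ltr0n standing_dim_gt0.
have E'S0 : 0 < \tr (update E X t *m S) by rewrite trE' divr_gt0 // addr_gt0.
have aw0 : 0 < alpha - wide alpha by nra.
split.
- split=> //.
  apply: (@QPopt_exists _ _ _ C A b y _ S alpha
    ((alpha - wide alpha) * (\tr (update E X t *m S) / n%:R))) => //.
  + exact: ltW.
  + exact/ltW/sqr_alpha_lt_dim.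
  + by rewrite mulr_gt0 // divr_gt0.
  + by move=> Y KY; apply: le_trans (KS Y KY); rewrite le_eqVlt; apply/orP; left;
      apply/eqP; ring.
- rewrite !(dual_decomp _ _ _ _ defC) // ltrD2l trE'.
  by rewrite ltr_pdivrMr ?addr_gt0 // mulrDr mulr1 ltrDl mulr_gt0.
move=> y' S' [_ maxy']; apply: (maxy' y S); split=> //; split=> // Y KY.
apply: le_trans (KS Y KY); rewrite mulr_ge0 ?(ltW aw0) // divr_ge0 ?(ltW nR0) //.
by rewrite mulr_ge0 ?(ltW E'S0) ?normE_ge0.
Qed.

End AffineScalingStep.

(** * Gap reduction from primal decrease or dual gain *)

Section GapReduction.
Context {R : realType} {n m : nat} {C : 'M[R]_n} {A : 'I_m -> 'M[R]_n}.
Context {b : 'cV[R]_m} {alpha : R}.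
Context (std : standing C A b) (a01 : 0 < alpha < 1).

Local Notation rate := (Num.sqrt n%:R / (kappa alpha + Num.sqrt n%:R)).

(** A small norm forces t >= alpha / (2 |X|_E) >= kappa / sqrt n. The dual gain is discarded, and
    the gap still shrinks by 1 / (1 + t). *)
Lemma primal_gap_reduction E X y S t y' S' : pdmx E -> Aop A E = b ->
  QPopt C A b E alpha X -> QPDopt C A b E alpha y S ->
  (forall s, tquad E X S t <= tquad E X S s) ->
  QPDopt C A b (update E X t) alpha y' S' ->
  2 * kappa alpha * normE E X <= alpha * Num.sqrt n%:R ->
  gapE C b (update E X t) y' <= rate * gapE C b E y.
Proof.
move=> pE AE optX opty tmin opty' small.
have [_ _ /(_ _ _ opty') leY] := step_improves std a01 _ _ _ _ _ pE AE optX opty tmin.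
have [N0 tge ES0 _ [AE' trE' _]] := step_facts std a01 _ _ _ _ _ pE AE optX opty tmin.
have [[defC _] _] := opty.
have r0 : 0 < Num.sqrt n%:R :> R by rewrite sqrtr_gt0 ltr0n (standing_dim_gt0 std).
have k0 := kappa_gt0 _ a01; have /andP[a0 a1] := a01.
have kt : kappa alpha <= t * Num.sqrt n%:R.
  rewrite -ler_pdivrMr //; apply: le_trans tge.
  by rewrite ler_pdivlMr ?mulr_gt0 // mulrAC ler_pdivrMr //; lra.
have t0 : 0 < t by apply: lt_le_trans tge; rewrite divr_gt0 // mulr_gt0.
apply: (@le_trans _ _ (gapE C b (update E X t) y)); first by rewrite lerB.
rewrite (gapE_dual _ _ _ AE' defC) (gapE_dual _ _ _ AE defC) trE' mulrC.
rewrite ler_wpM2r ?(ltW ES0) // ler_pdivlMr ?addr_gt0 // mulrC ler_pdivrMr ?addr_gt0 //.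
lra.
Qed.

(** Complementarity at the new point makes the new gap tr (E' S) - tr (X' S). A large norm of [X']
    makes the subtracted term at least kappa / sqrt n times tr (E' S); the primal decrease is
    discarded. *)
Lemma dual_gap_reduction E X y S t X' y' S' : pdmx E -> Aop A E = b ->
  QPopt C A b E alpha X -> QPDopt C A b E alpha y S ->
  (forall s, tquad E X S t <= tquad E X S s) ->
  QPopt C A b (update E X t) alpha X' ->
  QPDopt C A b (update E X t) alpha y' S' ->
  alpha * Num.sqrt n%:R <= 2 * kappa alpha * normE (update E X t) X' ->
  gapE C b (update E X t) y' <= rate * gapE C b E y.
Proof.
move=> pE AE optX opty tmin optX' opty' large.
have [N0 tge ES0 pE' [AE' trE' _]] := step_facts std a01 _ _ _ _ _ pE AE optX opty tmin.
have [XS'0 _ _ _] := complementary_slackness std a01 _ _ _ _ pE' AE' optX' opty'.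
have [[AX' KX'] _] := optX'.
have gain := step_Kdual std a01 _ _ _ _ _ pE AE optX opty tmin _ KX'.
have [[defC _] _] := opty; have [[defC' _] _] := opty'.
have n0 : 0 < n%:R :> R by rewrite ltr0n (standing_dim_gt0 std).
have r0 : 0 < Num.sqrt n%:R :> R by rewrite sqrtr_gt0.
have rr : Num.sqrt n%:R ^+ 2 = n%:R :> R by rewrite sqr_sqrtr // ltW.
have k0 := kappa_gt0 _ a01; have wg := wide_gap _ a01; have /andP[a0 a1] := a01.
have t0 : 0 < t by apply: lt_le_trans tge; rewrite divr_gt0 // mulr_gt0.
rewrite (gapE_dual _ _ _ AE defC).
have -> : gapE C b (update E X t) y' = \tr (update E X t *m S) - \tr (X' *m S).
  rewrite -(gapE_dual _ _ _ AE' defC) /gapE.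
  have := dual_decomp _ _ _ AX' defC'; rewrite (dual_decomp _ _ _ AX' defC) XS'0.
  lra.
have E'S0 : 0 < \tr (update E X t *m S) by rewrite trE' divr_gt0 // addr_gt0.
have E'S1 : \tr (update E X t *m S) <= \tr (E *m S).
  by rewrite trE' ler_pdivrMr ?addr_gt0 // mulrDr mulr1 lerDl mulr_ge0 ?ltW.
apply: (@le_trans _ _ (rate * \tr (update E X t *m S))); last first.
  by rewrite ler_wpM2l // divr_ge0 ?ltW // addr_gt0.
rewrite lerBlDr -lerBlDl; apply: le_trans gain.
move: (\tr (update E X t *m S)) E'S0 => g g0.
have ks := kappa_sqr _ a1.
move: large; set N := normE _ X' => large.
set r := Num.sqrt n%:R in r0 rr large *; set k := kappa alpha in k0 ks large *.
have wN : k / r <= (alpha - wide alpha) * N / n%:R.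
  rewrite ler_pdivlMr // -rr.
  have -> : k / r * r ^+ 2 = k * r by field; rewrite gt_eqF.
  have N00 : 0 <= N by exact: normE_ge0.
  have k20 : 0 < 2 * k by lra.
  apply: le_trans (ler_wpM2r N00 wg); rewrite -(ler_pM2l k20).
  (* The identity 2 kappa^2 = alpha^2 (1 - alpha) / 4 lets the primal and dual cases share one
     threshold on the norm. *)
  have -> : 2 * k * (k * r) = alpha * (1 - alpha) / 4 * (alpha * r).
    have -> : 2 * k * (k * r) = 2 * k ^+ 2 * r by ring.
    by rewrite ks; field.
  have -> : 2 * k * (alpha * (1 - alpha) / 4 * N) =
    alpha * (1 - alpha) / 4 * (2 * k * N) by ring.
  by rewrite ler_wpM2l // divr_ge0 // mulr_ge0 //; lra.
have -> : (alpha - wide alpha) * (g * N / n%:R) =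
  g * ((alpha - wide alpha) * N / n%:R) by ring.
have -> : g - r / (k + r) * g = g * (k / (k + r)).
  by field; rewrite gt_eqF // addr_gt0.
rewrite ler_pM2l //; apply: le_trans wN.
by rewrite ler_pM2l // lef_pV2 ?posrE ?addr_gt0 // lerDr ltW.
Qed.

End GapReduction.

(** * Single steps and two consecutive steps *)

Theorem mainTheorem1 (R : realType) (n m : nat)
  (C : 'M[R]_n) (A : 'I_m -> 'M[R]_n) (b : 'cV[R]_m) (alpha : R) :
  standing C A b -> 0 < alpha < 1 ->
  (forall (E X S : 'M[R]_n) (y : 'cV[R]_m) (t : R),
     Swath C A b alpha E ->
     QPopt C A b E alpha X ->
     QPDopt C A b E alpha y S ->
     (forall s, tquad E X S t <= tquad E X S s) ->
     [/\ Swath C A b alpha (update E X t),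
         \tr (C *m update E X t) < \tr (C *m E) &
         forall y' S', QPDopt C A b (update E X t) alpha y' S' ->
           bty b y <= bty b y'])
  /\
  (forall (Es Xs Ss : nat -> 'M[R]_n) (ys : nat -> 'cV[R]_m) (ts : nat -> R),
     Swath C A b alpha (Es 0%N) ->
     (forall i, QPopt C A b (Es i) alpha (Xs i)) ->
     (forall i, QPDopt C A b (Es i) alpha (ys i) (Ss i)) ->
     (forall i s, tquad (Es i) (Xs i) (Ss i) (ts i) <= tquad (Es i) (Xs i) (Ss i) s) ->
     (forall i, Es i.+1 = update (Es i) (Xs i) (ts i)) ->
     forall i, exists2 j : nat, (j == i) || (j == i.+1) &
       gapE C b (Es j.+1) (ys j.+1) / gapE C b (Es j) (ys j)
         <= 1 - kappa alpha / (kappa alpha + Num.sqrt (n%:R))).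
Proof.
move=> std a01; split=> [E X S y t [pE AE _] | Es Xs Ss ys ts sw0 optX opty tmin EsE i].
  exact: step_improves.
have sw j : Swath C A b alpha (Es j).
  elim: j => // j [pE AE _]; rewrite EsE.
  by have [] := step_improves std a01 _ _ _ _ _ pE AE (optX j) (opty j) (tmin j).
have r0 : 0 < Num.sqrt n%:R :> R by rewrite sqrtr_gt0 ltr0n (standing_dim_gt0 std).
have k0 := kappa_gt0 _ a01.
have -> : 1 - kappa alpha / (kappa alpha + Num.sqrt n%:R) =
    Num.sqrt n%:R / (kappa alpha + Num.sqrt n%:R).
  by field; rewrite gt_eqF // addr_gt0.
have gap0 j : 0 < gapE C b (Es j) (ys j).
  have [pE AE _] := sw j.
  have [_ _ ES0 _ _] := step_facts std a01 _ _ _ _ _ pE AE (optX j) (opty j) (tmin j).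
  by have [[defC _] _] := opty j; rewrite (gapE_dual _ _ _ AE defC).
(* If the optimal X at index i + 1 is small, step i + 1 is long and j = i + 1; if it is large, step
   i has already gained enough in the dual and j = i. *)
have [small|large] := leP (2 * kappa alpha * normE (Es i.+1) (Xs i.+1))
  (alpha * Num.sqrt n%:R).
  exists i.+1; rewrite ?eqxx ?orbT // ler_pdivrMr // EsE.
  have [pE AE _] := sw i.+1; have := opty i.+2; rewrite EsE.
  by move/(primal_gap_reduction std a01 _ _ _ _ _ _ _ pE AE
    (optX _) (opty _) (tmin _)); exact.
exists i; rewrite ?eqxx // ler_pdivrMr //.
have [pE AE _] := sw i; move: (optX i.+1) (opty i.+1) (ltW large); rewrite EsE.
exact: dual_gap_reduction.
Qed.
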